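(* For all integers $k \geq 1$ and $n\ge 1$, $$2^{2k-1} S_{2k-1}(n) = \sum_{m=1}^k Q_{k,m}(n) \binom{n+m}{2m-1},$$ where, for $1\le m\le k$, $Q_{k,m}(n)$ is an odd polynomial in $n$ of degree $2k-2m+1$ given by $$Q_{k,1}(n) = n^{2k-1}, \qquad Q_{k,m}(n) = 2\sum_{j=m}^k \binom{2k-1}{2j-2} R(j-1,m-1)\, n^{2k-2j+1} \quad \text{for } m \geq 2.$$
   Context: For integers $k, n\ge 1$, $S_k(n) = 1^k + 2^k + \cdots + n^k$. For integers $0 \le m \le k$, the numbers $R(k,m)$ (OEIS A304330) are defined by $$R(k,m) = \sum_{j=0}^m (-1)^j \binom{2m}{j} (m-j)^{2k},$$ with the convention $0^0=1$. Binomial coefficients $\binom{a}{b}$ with integers $0\le a<b$ are $0$. A polynomial $Q$ is odd if $Q(-n)=-Q(n)$. *)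

(* Defs.v *)
From HB Require Import structures.
From mathcomp Require Import all_boot all_order all_algebra.

Set Implicit Arguments.
Unset Strict Implicit.
Unset Printing Implicit Defensive.

Import Order.TTheory GRing.Theory Num.Theory.
Local Open Scope ring_scope.

Definition power_sum (k n : nat) : nat := (\sum_(1 <= i < n.+1) i ^ k)%N.

(* OEIS A304330, meaningful for m <= k. When k = 0 the term j = m uses
   0 ^+ 0 = 1, which is MathComp's convention. *)
Definition R304330 (k m : nat) : int :=
  \sum_(0 <= j < m.+1)
     (-1) ^+ j * 'C(2 * m, j)%:Z * (m%:Z - j%:Z) ^+ (2 * k).

(* Meaningful for 1 <= m <= k; in that range none of the natural-number
   subtractions truncates. *)
Definition Qpoly (k m : nat) : {poly int} :=
  if m == 1%N then 'X^(2 * k - 1)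
  else 2 *: \sum_(m <= j < k.+1)
         ('C(2 * k - 1, 2 * j - 2)%:Z * R304330 (j - 1) (m - 1))
           *: 'X^(2 * k - 2 * j + 1).

(* Not MathComp's odd_poly, which extracts the odd-degree part. *)
Definition is_odd_poly (Q : {poly int}) : Prop :=
  forall x : int, Q.[- x] = - Q.[x].

(* MathComp's size is the degree plus one, and 0 for the zero polynomial,
   which thus has no degree. *)
Definition has_degree (Q : {poly int}) (d : nat) : Prop := size Q = d.+1.

(* Main.v *)
Require Import Defs.
From HB Require Import structures.
From mathcomp Require Import all_boot all_order all_algebra.
From mathcomp Require Import zify ring.

(** The idea is to double the summation variable and centre it.  As
    2^(2k-1) S_(2k-1)(n) is the sum of (2i)^(2k-1) over 0 <= i <= n, write
    2i = n + d with d = 2i - n and expand by the binomial theorem.  The values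
    d = -n, -n+2, ..., n are symmetric about 0, so their odd power sums vanish
    and
      2^(2k-1) S_(2k-1)(n)
        = sum over r < k of C(2k-1, 2r) n^(2k-1-2r) T_r(n),
    where T_r(n) is the sum of d^(2r) ([power_sum_step2]).

    The numbers R(r,m) are central factorial numbers in disguise.  Put
    b_m(x) = C(x+m, 2m) + C(x+m-1, 2m), which equals
    2 x^2 (x^2 - 1) ... (x^2 - (m-1)^2) / (2m)!.  Comparing consecutive
    products gives
      (2m+2)(2m+1) b_(m+1)(x) = (x^2 - m^2) b_m(x)     ([central_binS]),
    while R satisfies the dual recurrence
      R(r+1, m+1) = (m+1)^2 R(r, m+1) + (2m+2)(2m+1) R(r, m)   ([R_succ]).
    Together they yield, by induction on r, for every r >= 1,
      x^(2r) = sum over 1 <= m <= r of R(r,m) b_m(x)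
    ([even_power_expansion]).

    Now T_r(n+2) - T_r(n) = 2 (n+2)^(2r), and by Pascal's rule
    C(n+m+3, 2m+1) - C(n+m+1, 2m+1) = b_m(n+2).  Hence the expansion above
    sums to T_r(n) = 2 * sum of R(r,m) C(n+m+1, 2m+1) for r >= 1
    ([step2_sum_even]), whereas T_0(n) = n+1.  Inserting these values and
    exchanging the two sums collects the coefficient of each binomial
    coefficient into Q_(k,m)(n).

    The degree of Q_(k,m) is read off its term j = m, whose coefficient is
    nonzero because the diagonal values R(r,r) are, by the recurrence for R. *)

Set Implicit Arguments.
Unset Strict Implicit.
Unset Printing Implicit Defensive.

Import Order.TTheory GRing.Theory Num.Theory.
Local Open Scope ring_scope.

Local Notation R := R304330.

(** * Binomial identities over the integers *)

(** Stated with integer subtraction, so that no comparison of the arguments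
    is needed: a negative factor always meets a vanishing binomial. *)
Lemma bin_upper (n k : nat) :
  (n.+1%:Z - k%:Z) * 'C(n.+1, k)%:Z = n.+1%:Z * 'C(n, k)%:Z :> int.
Proof.
have [lek|ltk] := leqP k n.+1; first by rewrite subzn // -!PoszM mul_bin_down.
by rewrite !bin_small ?mulr0 //; lia.
Qed.

Lemma bin_lower (n k : nat) :
  k.+1%:Z * 'C(n, k.+1)%:Z = (n%:Z - k%:Z) * 'C(n, k)%:Z :> int.
Proof.
have [lek|ltk] := leqP k n; first by rewrite subzn // -!PoszM mul_bin_left.
by rewrite !bin_small ?mulr0 //; lia.
Qed.

Lemma bin_diag (n k : nat) :
  k.+1%:Z * 'C(n.+1, k.+1)%:Z = n.+1%:Z * 'C(n, k)%:Z :> int.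
Proof. by rewrite -!PoszM -mul_bin_diag. Qed.

(** * The numbers R(r,m) *)

(** The recurrence holds term by term: (m-j)^2 = m^2 - j(2m-j), and j(2m-j)
    is absorbed by C(2m,j) at the cost of lowering m and j by one. *)
Lemma R_succ (r m : nat) :
  R r.+1 m.+1 = m.+1%:Z ^+ 2 * R r m.+1 + (2 * m + 2)%:Z * (2 * m + 1)%:Z * R r m.
Proof.
rewrite /R304330 (big_nat_recl m.+1) // (big_nat_recl m.+1) // !mulrDr -addrA; congr (_ + _).
  by rewrite !bin0 expr0 !subr0 mulnS exprD; ring.
rewrite !mulr_sumr -big_split /=; apply: eq_bigr => j _.
have absorb : ((2 * m + 2)%:Z * (2 * m + 1)%:Z * 'C(2 * m, j)%:Z
    = j.+1%:Z * ((2 * m + 1)%:Z - j%:Z) * 'C(2 * m.+1, j.+1)%:Z :> int).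
  have -> : (2 * m.+1 = (2 * m).+2)%N by lia.
  by rewrite addn1 addn2 -mulrA -bin_upper mulrCA -bin_diag; ring.
have -> : m.+1%:Z - j.+1%:Z = m%:Z - j%:Z :> int by lia.
have -> : (2 * r.+1 = 2 * r + 2)%N by lia.
rewrite exprD exprS !mulrA.
set P := _ ^+ (2 * r).
have -> : (2 * m + 2)%:Z * (2 * m + 1)%:Z * (-1) ^+ j * 'C(2 * m, j)%:Z * P
  = (2 * m + 2)%:Z * (2 * m + 1)%:Z * 'C(2 * m, j)%:Z * (-1) ^+ j * P :> int by ring.
rewrite absorb.
have -> : (2 * m + 1)%:Z = 2 * m%:Z + 1 :> int by lia.
have -> : j.+1%:Z = j%:Z + 1 :> int by lia.
have -> : m.+1%:Z = m%:Z + 1 :> int by lia.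
ring.
Qed.

(** With [R_zero_left], this gives R in row 0, where the defining sum is half
    of an alternating row of Pascal's triangle and does not vanish.  It is the starting
    point of the recurrence, and row 1 is the first that is triangular. *)
Lemma alternating_bin_sum (n M : nat) :
  \sum_(0 <= j < M.+1) (-1) ^+ j * 'C(n.+1, j)%:Z = (-1) ^+ M * 'C(n, M)%:Z :> int.
Proof.
elim: M => [|M IH]; first by rewrite big_nat1 !bin0.
by rewrite big_nat_recr //= IH binS PoszD exprS; ring.
Qed.

Lemma R_zero_left (m : nat) : R 0 m.+1 = (-1) ^+ m.+1 * 'C((2 * m).+1, m.+1)%:Z.
Proof.
rewrite -alternating_bin_sum; apply: eq_bigr => j _.
by rewrite expr0 mulr1 mulnS.
Qed.

Lemma R11 : R 1 1 = 1.
Proof. by rewrite /R304330 !big_nat_recr //= big_geq. Qed.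

(** The two terms of the recurrence cancel, since
    m^2 C(2m-1,m) = 2m(2m-1) C(2m-3,m-1). *)
Lemma R1_vanish (p : nat) : R 1 p.+2 = 0.
Proof.
rewrite R_succ !R_zero_left.
have e1 : (p.+2 * 'C((2 * p.+1).+1, p.+2) = (2 * p.+1).+1 * 'C(2 * p.+1, p.+1))%N.
  by rewrite -mul_bin_diag.
have e2 : ('C(2 * p.+1, p.+1) = 2 * 'C((2 * p).+1, p.+1))%N.
  have -> : (2 * p.+1 = (2 * p).+2)%N by lia.
  rewrite binS [RHS]mul2n -addnn; congr (_ + _)%N.
  rewrite -bin_sub; last by lia.
  by congr binomial; lia.
have e : p.+2%:Z * 'C((2 * p.+1).+1, p.+2)%:Z
  = (2 * p.+1).+1%:Z * (2 * 'C((2 * p).+1, p.+1)%:Z) :> int.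
  by rewrite -!PoszM e1 e2 PoszM.
have -> : p.+2%:Z ^+ 2 * ((-1) ^+ p.+2 * 'C((2 * p.+1).+1, p.+2)%:Z)
  = p.+2%:Z * (-1) ^+ p.+2 * (p.+2%:Z * 'C((2 * p.+1).+1, p.+2)%:Z) :> int by ring.
rewrite e exprS.
have -> : (2 * p.+1 + 2)%:Z = 2 * p.+2%:Z :> int by lia.
rewrite addn1; ring.
Qed.

Lemma R_zero_right (r : nat) : R r.+1 0 = 0.
Proof. by rewrite /R304330 big_nat1 subrr expr0n mulr0. Qed.

(** Allows every sum over m <= r to be extended to a common upper bound, which
    makes double sums rectangular. *)
Lemma R_vanish (r m : nat) : (r < m)%N -> R r.+1 m.+1 = 0.
Proof.
elim: r m => [|r IH] [|m] // lt_rm; first exact: R1_vanish.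
by rewrite R_succ !IH ?mulr0 ?addr0 //; lia.
Qed.

Lemma R_diag_neq0 (r : nat) : R r.+1 r.+1 != 0.
Proof.
elim: r => [|r IH]; first by rewrite R11.
by rewrite R_succ R_vanish // mulr0 add0r !mulf_neq0 //; lia.
Qed.

(** * Expansion of even powers *)

(** The function b_m of the introduction at x = y+1; the shift avoids
    truncated subtraction in C(x+m-1, 2m). *)
Definition central_bin (m y : nat) : int :=
  ('C(y + m + 1, 2 * m) + 'C(y + m, 2 * m))%N%:Z.

(** With n = y+m and k = 2m, both sides are multiples of C(n,k): the factors
    x+m = n+1 and x-m = n+1-k of x^2 - m^2 are the ones that move the indices
    of the binomials. *)
Lemma central_binS (m y : nat) :
  (2 * m + 2)%:Z * (2 * m + 1)%:Z * central_bin m.+1 y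
  = (y.+1%:Z ^+ 2 - m%:Z ^+ 2) * central_bin m y.
Proof.
rewrite /central_bin.
have -> : (2 * m.+1 = (2 * m).+2)%N by lia.
have -> : (y + m.+1 + 1 = (y + m).+2)%N by lia.
have -> : (y + m.+1 = (y + m).+1)%N by lia.
rewrite !addn1 addn2 !PoszD.
set n := (y + m)%N; set k := (2 * m)%N.
have d1 := bin_diag n.+1 k.+1; have d2 := bin_diag n k.
have d3 := bin_diag n k.+1; have l := bin_lower n k; have u := bin_upper n k.
have ek : k%:Z = 2 * m%:Z :> int by lia.
have -> : y.+1%:Z = n.+1%:Z - m%:Z :> int by lia.
have en : n.+1%:Z = n%:Z + 1 :> int by lia.
have en2 : n.+2%:Z = n%:Z + 2 :> int by lia.
have -> : k.+2%:Z * k.+1%:Z * ('C(n.+2, k.+2)%:Z + 'C(n.+1, k.+2)%:Z)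
  = k.+1%:Z * (k.+2%:Z * 'C(n.+2, k.+2)%:Z) + k.+1%:Z * (k.+2%:Z * 'C(n.+1, k.+2)%:Z)
  :> int by ring.
rewrite d1 d3 mulrCA d2 [k.+1%:Z * _]mulrCA l.
have -> : ((n.+1%:Z - m%:Z) ^+ 2 - m%:Z ^+ 2) * ('C(n.+1, k)%:Z + 'C(n, k)%:Z)
  = n.+1%:Z * ((n.+1%:Z - k%:Z) * 'C(n.+1, k)%:Z + (n.+1%:Z - k%:Z) * 'C(n, k)%:Z)
  :> int by rewrite ek; ring.
rewrite u en en2; ring.
Qed.

(** Multiplying by x^2 replaces b_m with m^2 b_m + (2m+2)(2m+1) b_(m+1), which
    turns the coefficients R(r,.) into R(r+1,.). *)
Lemma even_power_expansion (N r y : nat) : (r < N)%N ->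
  y.+1%:Z ^+ (2 * r.+1) = \sum_(s < N) R r.+1 s.+1 * central_bin s.+1 y.
Proof.
elim: r => [|r IH] lt_rN.
  case: N lt_rN => // N _.
  rewrite big_ord_recl R11 mul1r big1 ?addr0 => [|i _]; last first.
    by rewrite R_vanish ?mul0r.
  (* b_1 comes from b_0 = 2, the case m = 0 of the recurrence for b. *)
  apply: (@mulfI _ ((2 * 0 + 2)%:Z * (2 * 0 + 1)%:Z)) => //.
  by rewrite central_binS /central_bin muln0 !bin0; ring.
pose G s := (2 * s + 2)%:Z * (2 * s + 1)%:Z * R r.+1 s * central_bin s.+1 y.
(* Reindexing is free: the term s = 0 contains R(r+1,0) = 0, and the term
   s = N contains R(r+1,N), which is above the diagonal. *)
have shift : \sum_(s < N) G s = \sum_(s < N) G s.+1.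
  apply: (@addIr _ (G N)); rewrite -(big_ord_recr N (fun s => G (val s))) /=.
  rewrite big_ord_recl /= [G N]/G [in RHS](_ : R r.+1 N = 0); last first.
    by case: N lt_rN {IH} => // N lt; apply: R_vanish; lia.
  by rewrite [G 0%N]/G R_zero_right !mulr0 !mul0r add0r addr0.
have -> : (2 * r.+2 = 2 + 2 * r.+1)%N by lia.
rewrite exprD IH; last by lia.
transitivity (\sum_(s < N) (s.+1%:Z ^+ 2 * R r.+1 s.+1 * central_bin s.+1 y) + \sum_(s < N) G s).
  rewrite shift -big_split mulr_sumr; apply: eq_bigr => s _ /=.
  have := central_binS s.+1 y; rewrite /G => e.
  have -> : (2 * s.+1 + 2)%:Z * (2 * s.+1 + 1)%:Z * R r.+1 s.+1 * central_bin s.+2 y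
    = R r.+1 s.+1 * ((2 * s.+1 + 2)%:Z * (2 * s.+1 + 1)%:Z * central_bin s.+2 y) :> int by ring.
  by rewrite e; ring.
by rewrite -big_split; apply: eq_bigr => s _; rewrite [R r.+2 _]R_succ mulrDl.
Qed.

(** * Power sums over -n, -n+2, ..., n *)

Definition step2_sum (p n : nat) : int :=
  \sum_(0 <= i < n.+1) ((2 * i)%:Z - n%:Z) ^+ p.

Lemma step2_sum_odd (p n : nat) : odd p -> step2_sum p n = 0.
Proof.
move=> odd_p.
suff : step2_sum p n = - step2_sum p n by move/eqP; rewrite -addr_eq0 -mulr2n mulrn_eq0 => /eqP.
rewrite {1}/step2_sum big_nat_rev /step2_sum -sumrN !big_nat.
apply: eq_bigr => i /andP[_ lti].
have -> : (2 * (0 + n.+1 - i.+1))%:Z - n%:Z = - ((2 * i)%:Z - n%:Z) :> int by lia.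
by rewrite exprNn -signr_odd odd_p mulN1r.
Qed.

Lemma step2_sum0 (n : nat) : step2_sum 0 n = n.+1%:Z.
Proof.
rewrite /step2_sum (eq_bigr (fun=> 1)) // big_const_nat subn0 iter_addr_0.
exact: natz.
Qed.

(** Passing from n to n+2 adds only the two endpoints -(n+2) and n+2. *)
Lemma step2_sumSS (p n : nat) : ~~ odd p ->
  step2_sum p n.+2 = 2 * n.+2%:Z ^+ p + step2_sum p n.
Proof.
move=> even_p; rewrite /step2_sum big_nat_recl // big_nat_recr //=.
have -> : (2 * 0)%:Z - n.+2%:Z = - n.+2%:Z :> int by lia.
have -> : (2 * n.+2)%:Z - n.+2%:Z = n.+2%:Z :> int by lia.
rewrite exprNn -signr_odd (negbTE even_p) expr0.
under eq_bigr => i _ do have -> : (2 * i.+1)%:Z - n.+2%:Z = (2 * i)%:Z - n%:Z :> int by lia.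
ring.
Qed.

(** Both sides grow from n to n+2 by the same amount: on the left
    2 (n+2)^(2r), on the right its expansion, because Pascal's rule used twice
    gives C(n+m+3, 2m+1) - C(n+m+1, 2m+1) = b_m(n+2). *)
Lemma step2_sum_even (N r n : nat) : (r < N)%N ->
  step2_sum (2 * r.+1) n
  = 2 * \sum_(s < N) R r.+1 s.+1 * 'C(n + s.+2, 2 * s.+1 + 1)%:Z.
Proof.
move=> lt_rN; have even : ~~ odd (2 * r.+1) by rewrite mul2n odd_double.
(* The induction has step two, so it carries two consecutive values. *)
suff: step2_sum (2 * r.+1) n
    = 2 * \sum_(s < N) R r.+1 s.+1 * 'C(n + s.+2, 2 * s.+1 + 1)%:Z /\
  step2_sum (2 * r.+1) n.+1
    = 2 * \sum_(s < N) R r.+1 s.+1 * 'C(n.+1 + s.+2, 2 * s.+1 + 1)%:Z by case.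
elim: n => [|n [IH0 IH1]].
  split.
    rewrite /step2_sum big_nat1 subrr expr0n big1 // => s _.
    by rewrite bin_small ?mulr0 //; lia.
  transitivity (2 * 1%:Z ^+ (2 * r.+1) : int).
    rewrite /step2_sum !big_nat_recr //= big_geq // add0r sub0r.
    by rewrite exprNn -signr_odd (negbTE even) !expr1n.
  rewrite (even_power_expansion 0 lt_rN); congr (_ * _); apply: eq_bigr => s _.
  have -> : (1 + s.+2 = s.+2.+1)%N by lia.
  rewrite /central_bin add0n addn1 [in RHS]addn1 [in RHS]binS.
  by rewrite (@bin_small s.+1) ?(@bin_small s.+2 (2 * s.+1).+1) ?addn0 //; lia.
split=> //; rewrite step2_sumSS // IH0 (even_power_expansion _ lt_rN) -mulrDr -big_split.
congr (_ * _); apply: eq_bigr => s _ /=.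
rewrite -mulrDr /central_bin -PoszD; congr (_ * Posz _).
have -> : (n.+2 + s.+2 = (n + s.+2).+2)%N by lia.
have -> : (n.+1 + s.+1 + 1 = (n + s.+2).+1)%N by lia.
have -> : (n.+1 + s.+1 = n + s.+2)%N by lia.
by rewrite addn1 !binS; lia.
Qed.

(** * Centring the odd power sum *)

Lemma sum_pairs (F : nat -> int) (N : nat) :
  \sum_(p < 2 * N) F p = \sum_(r < N) (F (2 * r)%N + F (2 * r).+1).
Proof.
elim: N => [|N IH]; first by rewrite !big_ord0.
have -> : (2 * N.+1 = (2 * N).+2)%N by lia.
by rewrite !big_ord_recr /= IH addrA.
Qed.

(** Expand (2i)^p = (n + (2i - n))^p; by symmetry only the even powers of
    2i - n contribute. *)
Lemma power_sum_step2 (K n : nat) :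
  2 ^+ (2 * K + 1) * (power_sum (2 * K + 1) n)%:Z
  = \sum_(r < K.+1) 'C(2 * K + 1, 2 * r)%:Z * n%:Z ^+ (2 * K + 1 - 2 * r)
       * step2_sum (2 * r) n.
Proof.
transitivity (\sum_(p < 2 * K.+1) 'C(2 * K + 1, p)%:Z * n%:Z ^+ (2 * K + 1 - p)
       * step2_sum p n); last first.
  rewrite (sum_pairs (fun p => 'C(2 * K + 1, p)%:Z * n%:Z ^+ (2 * K + 1 - p)
       * step2_sum p n)); apply: eq_bigr => r _.
  by rewrite [step2_sum _.+1 _]step2_sum_odd ?mulr0 ?addr0 //= mul2n odd_double.
transitivity (\sum_(0 <= i < n.+1) (n%:Z + ((2 * i)%:Z - n%:Z)) ^+ (2 * K + 1) : int).
  rewrite /power_sum [RHS]big_nat_recl // muln0 sub0r subrr expr0n addn1 /= add0r.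
  rewrite big_add1 /= -natz natr_sum mulr_sumr; apply: eq_bigr => i _.
  have -> : n%:Z + ((2 * i.+1)%:Z - n%:Z) = 2 * i.+1%:Z :> int by lia.
  by rewrite exprMn natrX (natz i.+1).
under eq_bigr => i _ do rewrite exprDn.
rewrite exchange_big /=.
have -> : (2 * K.+1 = (2 * K + 1).+1)%N by lia.
apply: eq_bigr => p _; rewrite /step2_sum mulr_sumr; apply: eq_bigr => i _.
by rewrite -mulr_natl natz mulrA.
Qed.

(** * The polynomials Q *)

(** Starting the sum at r = 0 only adds terms with R above the diagonal; its
    range then no longer depends on s. *)
Lemma QpolySS (K s : nat) : (s < K)%N ->
  Qpoly K.+1 s.+2 = 2 *: \sum_(r < K)
     ('C(2 * K + 1, 2 * r.+1)%:Z * R r.+1 s.+1) *: 'X^(2 * K + 1 - 2 * r.+1).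
Proof.
move=> lt_sK; rewrite /Qpoly /=; congr (_ *: _).
rewrite -(big_mkord xpredT (fun r => ('C(2 * K + 1, 2 * r.+1)%:Z * R r.+1 s.+1)
   *: 'X^(2 * K + 1 - 2 * r.+1))).
rewrite [RHS](@big_cat_nat _ _ _ s) //=; last by lia.
rewrite [X in _ = X + _]big1_seq ?add0r => [|r]; last first.
  by rewrite mem_index_iota => /andP[_ ltr]; rewrite R_vanish // mulr0 scale0r.
rewrite 2!big_add1 /= !big_nat; apply: eq_bigr => r /andP[_ ltr].
congr (('C(_, _)%:Z * R _ _) *: 'X^_); lia.
Qed.

Lemma Qpoly_odd (k m : nat) : (1 <= k)%N -> is_odd_poly (Qpoly k m).
Proof.
move=> hk x; rewrite /Qpoly; case: ifP => _.
  rewrite !hornerXn exprNn -signr_odd.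
  have -> : odd (2 * k - 1) by lia.
  by rewrite expr1 mulN1r.
rewrite !hornerZ !horner_sum -mulrN -sumrN; congr (_ * _).
apply: eq_bigr => j _; rewrite !hornerZ !hornerXn exprNn -signr_odd.
have -> : odd (2 * k - 2 * j + 1) by lia.
by rewrite expr1 mulN1r mulrN.
Qed.

Lemma Qpoly_degree (k m : nat) : (1 <= m <= k)%N ->
  has_degree (Qpoly k m) (2 * k - 2 * m + 1).
Proof.
case/andP=> m_gt0 le_mk; rewrite /has_degree /Qpoly.
have [-> | m_neq1] := eqVneq; first by rewrite size_polyXn; lia.
rewrite size_scale // big_ltn //.
(* The term j = m has strictly larger degree than all the others. *)
have c_neq0 : 'C(2 * k - 1, 2 * m - 2)%:Z * R (m - 1) (m - 1) != 0.
  apply: mulf_neq0; first by rewrite -lt0n bin_gt0; lia.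
  have -> : (m - 1 = (m - 2).+1)%N by lia.
  exact: R_diag_neq0.
rewrite size_polyDl size_scale ?size_polyXn // ltnS.
apply: leq_trans (size_sum _ _ _) _; rewrite big_nat.
elim/big_ind: _ => // [a b ha hb|j /andP[ltm ltk]]; first by rewrite geq_max ha.
by apply: leq_trans (size_scale_leq _ _) _; rewrite size_polyXn; lia.
Qed.

(** * The formula for odd power sums *)

Theorem theorem10 (k : nat) (hk : (1 <= k)%N) :
  (forall m : nat, (1 <= m <= k)%N ->
     is_odd_poly (Qpoly k m) /\ has_degree (Qpoly k m) (2 * k - 2 * m + 1)) /\
  (forall n : nat, (1 <= n)%N ->
     2 ^+ (2 * k - 1) * (power_sum (2 * k - 1) n)%:Z =
     \sum_(1 <= m < k.+1) (Qpoly k m).[n%:Z] * 'C(n + m, 2 * m - 1)%:Z).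
Proof.
split=> [m hm | n _]; first by split; [exact: Qpoly_odd | exact: Qpoly_degree].
case: k hk => // K _.
have -> : (2 * K.+1 - 1 = 2 * K + 1)%N by lia.
rewrite power_sum_step2 big_add1 /= big_mkord !big_ord_recl.
congr (_ + _).
  rewrite muln0 bin0 subn0 step2_sum0 mul1r /Qpoly /= hornerXn bin1 addn1.
  by congr (_ ^+ _ * _); lia.
(* The term r = 0, where T_0(n) = n + 1, has given Q_(k,1); it remains to
   exchange the sums for r >= 1 and m = s + 2. *)
transitivity (\sum_(r < K) \sum_(s < K)
   2 * ('C(2 * K + 1, 2 * r.+1)%:Z * R r.+1 s.+1) * n%:Z ^+ (2 * K + 1 - 2 * r.+1)
     * 'C(n + s.+2, 2 * s.+1 + 1)%:Z : int).
  apply: eq_bigr => r _.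
  rewrite (step2_sum_even n (ltn_ord r)) !mulr_sumr.
  by apply: eq_bigr => s _; rewrite !lift0; ring.
rewrite exchange_big; apply: eq_bigr => s _.
rewrite !lift0 QpolySS // hornerZ horner_sum mulr_sumr mulr_suml.
have -> : (2 * s.+2 - 1 = 2 * s.+1 + 1)%N by lia.
by apply: eq_bigr => r _; rewrite hornerZ hornerXn !mulrA.
Qed.
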